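(* Let $g\in C^1(\mathbb{R})$, let $p$ be a probability measure on $\mathbb{R}$, and let $x_1,x_2,\ldots$ be independent and identically distributed with law $p$. Let $T(m)=g(\overline{m})$, let $v_{jack}=v_{jack}(x_1,\ldots,x_n)$ be the jackknife variance estimator for the functional $T$, let $\mathbb{E}_{\epsilon_n}\phi_{\epsilon_n}^2$ be the infinitesimal jackknife variance estimator, and let $\sigma^2 = g'(\overline{p})^2\left\{\int x^2\,p(dx)-\overline{p}^2\right\}$. If $g'$ is globally H\''older continuous of order $h>1/2$ and $p$ has a finite moment of order $2(1+h)$, then $$n^{1/2}\left(v_{jack}-\sigma^2\right)\quad\text{and}\quad n^{1/2}\left(\mathbb{E}_{\epsilon_n}\phi_{\epsilon_n}^2-\sigma^2\right)$$ have the same limit in distribution as $n\to\infty$, if any (that is, if either sequence converges in distribution, then so does the other, and to the same limit).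
   Context: For a finite signed measure $q$ on $\mathbb{R}$ with finite first moment, $\overline{q}=\int x\,q(dx)$. The functional is $T(m)=g(\overline{m})$, defined for all finite signed measures $m$ with finite first moment. Its influence function at a probability measure $m$ is $\phi_m(x)=g'(\overline{m})(x-\overline{m})$. Given data $x_1,\ldots,x_n$ ($n\ge 2$), with $\delta(x)$ the point mass at $x$, set $$\epsilon_n=\frac1n\sum_{i=1}^n\delta(x_i),\qquad \epsilon_{ni}=\frac{1}{n-1}\sum_{j\neq i}\delta(x_j).$$ The jackknife pseudovalues are $Q_{ni}=nT(\epsilon_n)-(n-1)T(\epsilon_{ni})$, $i=1,\ldots,n$, and the jackknife variance estimator is $$v_{jack}(x_1,\ldots,x_n)=\frac{1}{n-1}\sum_{i=1}^n\left(Q_{ni}-\overline{Q_n}\right)^2,\qquad \overline{Q_n}=\frac1n\sum_{j=1}^nQ_{nj}.$$ The infinitesimal jackknife variance estimator is $$\mathbb{E}_{\epsilon_n}\phi_{\epsilon_n}^2=\frac1n\sum_{i=1}^n\phi_{\epsilon_n}(x_i)^2=\frac1n\sum_{i=1}^n g'(\overline{\epsilon_n})^2(x_i-\overline{\epsilon_n})^2 .$$ *)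

(* Defs.v *)
From HB Require Import structures.
From mathcomp Require Import all_boot all_order all_algebra.
From mathcomp Require Import all_classical all_reals all_analysis.
From mathcomp Require Import measurable_realfun.

Set Implicit Arguments.
Unset Strict Implicit.
Unset Printing Implicit Defensive.

Import Order.TTheory GRing.Theory Num.Theory.
Import numFieldNormedType.Exports.

Local Open Scope classical_set_scope.
Local Open Scope ring_scope.

(* \sum_(i < n | I i) nu i, as a charge. *)
Section charge_sum.
Local Open Scope ereal_scope.
Context d (T : measurableType d) (R : realType) (n : nat).
Variables (nu : 'I_n -> {charge set T -> \bar R}) (I : pred 'I_n).

Definition csum (A : set T) : \bar R := \sum_(i < n | I i) nu i A.

Let csum0 : csum set0 = 0.
Proof. by rewrite /csum big1// => i _; rewrite charge0. Qed.

Let csum_finite A : measurable A -> csum A \is a fin_num.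
Proof. by move=> mA; apply/sum_fin_numP => i _ _; rewrite fin_num_measure. Qed.

Let csum_sigma_additive : semi_sigma_additive csum.
Proof.
move=> F mF tF mUF.
have fin i : nu i (\bigcup_k F k) \is a fin_num by rewrite fin_num_measure.
suff H (s : seq 'I_n) :
    (\sum_(i <- s | I i) \sum_(0 <= j < k) nu i (F j)) @[k --> \oo] -->
    \sum_(i <- s | I i) nu i (\bigcup_k F k).
  rewrite [X in X @ _ --> _](_ : _ = (fun k =>
    \sum_(i < n | I i) \sum_(0 <= j < k) nu i (F j))); first exact: H.
  by apply/funext => k; rewrite exchange_big.
elim: s => [|i s IHs].
  by under eq_fun do rewrite big_nil; rewrite big_nil; exact: cvg_cst.
under eq_fun do rewrite big_cons.
rewrite big_cons; case: ifPn => // _.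
apply: cvgeD => //; last exact: charge_semi_sigma_additive.
by rewrite fin_num_adde_defr.
Qed.

HB.instance Definition _ := isCharge.Build _ _ _ csum
  csum0 csum_finite csum_sigma_additive.

End charge_sum.

(* Integral against a finite signed measure, through its Jordan decomposition
   (which does not depend on the chosen Hahn decomposition). As for Rintegral,
   the value is junk when f is not integrable. *)
Section charge_integral.
Context d (T : measurableType d) (R : realType).
Implicit Types (nu : {charge set T -> \bar R}) (f : T -> R).

Lemma Hahn_pair nu : {PN : set T * set T | hahn_decomposition nu PN.1 PN.2}.
Proof.
by apply/cid; have [P [N PN]] := Hahn_decomposition nu; exists (P, N).
Qed.

Definition charge_integral nu f : R :=
  \int[jordan_pos (projT2 (Hahn_pair nu))]_x f x -
  \int[jordan_neg (projT2 (Hahn_pair nu))]_x f x.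

Lemma charge_integral_measure (mu : {measure set T -> \bar R}) nu f :
  measurable_fun setT f -> (forall A, measurable A -> nu A = mu A) ->
  charge_integral nu f = \int[mu]_x f x.
Proof.
move=> mf numu; rewrite /charge_integral.
case: (Hahn_pair nu) => -[P N] /= PN.
have [[mP posP] [mN negN] PNT PN0] := PN.
have N0 A : measurable A -> nu (A `&` N) = 0%E.
  move=> mA; apply/eqP; rewrite eq_le negN ?andTb//; last exact: measurableI.
  by rewrite numu ?measure_ge0//; exact: measurableI.
have neg0 A : measurable A -> jordan_neg PN A = 0%E.
  move=> mA; rewrite jordan_negE cjordan_negE /crestr0 mem_set// /crestr N0//.
  by rewrite oppe0.
have posE A : measurable A -> jordan_pos PN A = mu A.
  move=> mA; rewrite jordan_posE cjordan_posE /crestr0 mem_set// /crestr -numu//.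
  by rewrite [RHS](charge_partition nu _ mP mN)// N0// adde0.
rewrite [X in _ - X](_ : _ = 0) ?subr0; last first.
  rewrite /Rintegral null_set_integral//; first exact/measurable_EFinP.
  exact: neg0.
rewrite /Rintegral; congr fine.
by apply: eq_measure_integral => A mA _; exact: posE.
Qed.

End charge_integral.

Section functional.
Context (R : realType).
Implicit Types (m : {charge set R -> \bar R}) (g : R -> R).

Definition charge_mean m : R := charge_integral m id.

Definition functional_T g m : R := g (charge_mean m).

Definition influence g m (x : R) : R :=
  derive1 g (charge_mean m) * (x - charge_mean m).

End functional.

Definition point_mass (R : realType) (y : R) : {charge set R -> \bar R} :=
  charge_of_finite_measure (dirac y).

(* x_1, ..., x_n is x 0, ..., x (n - 1); for n < 2 the estimators take junk
   values. *)
Section jackknife.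
Context (R : realType) (g : R -> R) (n : nat) (x : 'I_n -> R).

Definition emp : {charge set R -> \bar R} :=
  cscale n%:R^-1 (csum (fun i => point_mass (x i)) xpredT).

Definition emp_del (i : 'I_n) : {charge set R -> \bar R} :=
  cscale n.-1%:R^-1 (csum (fun j => point_mass (x j)) (fun j => j != i)).

Definition pseudovalue (i : 'I_n) : R :=
  n%:R * functional_T g emp - n.-1%:R * functional_T g (emp_del i).

Definition pseudovalue_mean : R := n%:R^-1 * \sum_(j < n) pseudovalue j.

Definition v_jack : R :=
  n.-1%:R^-1 * \sum_(i < n) (pseudovalue i - pseudovalue_mean) ^+ 2.

Definition v_infjack : R :=
  charge_integral emp (fun y => influence g emp y ^+ 2).

End jackknife.

Section probability_notions.
Context d (Omega : measurableType d) (R : realType) (P : probability Omega R).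

Definition mutually_independent (X : nat -> {RV P >-> R}) : Prop :=
  forall (s : seq nat) (B : nat -> set R),
    uniq s -> (forall i, measurable (B i)) ->
    (P (\bigcap_(i in [set` s]) (X i @^-1` B i)) =
     \prod_(i <- s) P (X i @^-1` B i))%E.

Definition iid_with_law (X : nat -> {RV P >-> R}) (p : probability R R) : Prop :=
  mutually_independent X /\
  forall i (B : set R), measurable B -> distribution P (X i) B = p B.

(* Weak convergence of the laws of Y n to mu; meant for measurable Y n. *)
Definition cvg_in_distribution (Y : nat -> Omega -> R) (mu : probability R R)
    : Prop :=
  forall f : R -> R, continuous f -> bounded_fun f ->
    (\int[P]_w f (Y n w)) @[n --> \oo] --> \int[mu]_y f y.

End probability_notions.

Definition C1 (R : realType) (g : R -> R) : Prop :=
  (forall x : R, derivable g x 1) /\ continuous (derive1 g).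

Definition holder_continuous (R : realType) (h : R) (f : R -> R) : Prop :=
  exists C : R, forall x y : R, `|f x - f y| <= C * `|x - y| `^ h.

Definition finite_abs_moment (R : realType) (p : probability R R) (r : R)
    : Prop :=
  (\int[p]_x (`|x| `^ r)%:E < +oo)%E.

Definition asymptotic_variance (R : realType) (g : R -> R)
    (p : probability R R) : R :=
  let m := charge_mean (charge_of_finite_measure p) in
  derive1 g m ^+ 2 * (\int[p]_x (x ^+ 2) - m ^+ 2).

(* Main.v *)
Require Import Defs.
From HB Require Import structures.
From mathcomp Require Import all_boot all_order all_algebra.
From mathcomp Require Import all_classical all_reals all_analysis.
From mathcomp Require Import measurable_realfun ring lra.
Import Order.TTheory GRing.Theory Num.Theory.
Import numFieldNormedType.Exports.
Local Open Scope classical_set_scope.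
Local Open Scope ring_scope.

(* Write M for the sample mean, d_i = x_i - M and q = n - 1. Deleting x_i moves
   the mean to M - d_i / q, so a first-order expansion of g at M gives
   Q_i = g(M) + g'(M) d_i - q r_i with |r_i| <= C (|d_i| / q)^(1+h). Hence
   sqrt n * |v_jack - v_infjack| is at most a constant times
   (n^(-1/2) + n^(1/2-h)) times the average of 1 + |x_i|^(2(1+h)): the factor
   g'(M)^2 costs |M|^(2h), and |M|^(2(1+h)) is dominated by the average of the
   |x_i|^(2(1+h)) by convexity. That average has constant expectation, so the two
   normalised estimators differ by a quantity that tends to 0 in L^1, and they
   have the same limit in distribution. *)

(** * Integrals against empirical measures *)

Definition atoms {R : realType} {n : nat} (x : 'I_n -> R) (I : pred 'I_n)
    (k : nat) : {measure set R -> \bar R} :=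
  if insub k is Some i then
    if I i then dirac (x i) : {measure set R -> \bar R} else mzero
  else mzero.

Lemma ge0_integral_atoms {R : realType} {n : nat} (c : {nonneg R})
    (x : 'I_n -> R) (I : pred 'I_n) (f : R -> R) :
  measurable_fun setT f -> (forall y, 0 <= f y) ->
  (\int[mscale c (msum (atoms x I) n)]_y (f y)%:E =
   (c%:num * \sum_(i < n | I i) f (x i))%:E)%E.
Proof.
move=> mf f0; have mf' : measurable_fun setT (EFin \o f) by exact/measurable_EFinP.
rewrite ge0_integral_mscale//; last by move=> y _; rewrite lee_fin.
rewrite EFinM; congr (_ * _)%E.
rewrite ge0_integral_measure_sum//; last by move=> y _; rewrite lee_fin.
rewrite -sumEFin [RHS]big_mkcond/=; apply: eq_bigr => i _; rewrite /atoms valK.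
by case: ifPn => _; rewrite ?integral_measure_zero// integral_dirac// diracT mul1e.
Qed.

Lemma charge_integral_atoms {R : realType} {n : nat} (c : R) (x : 'I_n -> R)
    (I : pred 'I_n) (f : R -> R) : 0 <= c -> measurable_fun setT f ->
  charge_integral (cscale c (csum (fun i => point_mass (x i)) I)) f =
  c * \sum_(i < n | I i) f (x i).
Proof.
move=> c0 mf.
have mE A : measurable A ->
    cscale c (csum (fun i => point_mass (x i)) I) A =
    mscale (NngNum c0) (msum (atoms x I) n) A.
  move=> mA; rewrite /cscale /mscale /=; congr (_ * _)%E.
  rewrite /csum /msum [LHS]big_mkcond/=; apply: eq_bigr => i _.
  by rewrite /atoms valK; case: ifPn.
rewrite (charge_integral_measure mf mE) /Rintegral integralE.
have -> : (fun y => (f y)%:E) = EFin \o f by [].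
rewrite funerpos funerneg !ge0_integral_atoms//=.
- rewrite -mulrBr -sumrB; congr (_ * _); apply: eq_bigr => i _.
  by rewrite -[in RHS](funrposBneg f).
- exact: measurable_funrneg.
- exact: measurable_funrpos.
Qed.

Lemma charge_mean_emp {R : realType} {n : nat} (x : 'I_n -> R) :
  charge_mean (emp x) = n%:R^-1 * \sum_(i < n) x i.
Proof.
by rewrite /charge_mean charge_integral_atoms// ?invr_ge0 ?ler0n//; exact: measurable_id.
Qed.

Lemma charge_mean_emp_del {R : realType} {n : nat} (x : 'I_n -> R) (i : 'I_n) :
  charge_mean (emp_del x i) = n.-1%:R^-1 * \sum_(j < n | j != i) x j.
Proof.
by rewrite /charge_mean charge_integral_atoms// ?invr_ge0 ?ler0n//; exact: measurable_id.
Qed.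

Lemma v_infjackE {R : realType} (g : R -> R) {n : nat} (x : 'I_n -> R)
    (M := n%:R^-1 * \sum_(i < n) x i) :
  v_infjack g x = n%:R^-1 * \sum_(i < n) (derive1 g M * (x i - M)) ^+ 2.
Proof.
rewrite /v_infjack charge_integral_atoms ?invr_ge0 ?ler0n//.
  by rewrite /influence charge_mean_emp.
apply: measurable_funX; apply: measurable_funM => //.
by apply: measurable_funB => //; exact: measurable_id.
Qed.

Lemma charge_mean_emp_delE {R : realType} {N : nat} (x : 'I_N.+2 -> R)
    (i : 'I_N.+2) (M := charge_mean (emp x)) :
  charge_mean (emp_del x i) = M - (x i - M) / N.+1%:R.
Proof.
rewrite charge_mean_emp_del [N.+2.-1]/= /M charge_mean_emp [\sum_(j < N.+2) x j](bigD1 i)//=.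
set s := \sum_(j < _ | _) _; have N0 : N.+1%:R != 0 :> R by rewrite pnatr_eq0.
have M0 : N.+2%:R != 0 :> R by rewrite pnatr_eq0.
by rewrite -[N.+2%:R]natr1; field; rewrite ?[1 + _]addrC ?natr1 ?N0 ?M0.
Qed.

(** * Pointwise comparison of the two estimators *)

(* Since the d_i sum to 0, the mean of Q only involves c and the mean of r, so
   beyond G d only the deviations of r contribute. *)
Lemma jackknife_dispersion_gap {R : realFieldType} {n : nat} {q G c : R}
    {d r Q : 'I_n.+1 -> R} (N := n.+1%:R) (mean := N^-1 * \sum_j Q j) :
  0 < q -> q < N -> N - q <= 1 -> \sum_i d i = 0 ->
  (forall i, Q i = c + G * d i - q * r i) ->
  `|q^-1 * \sum_i (Q i - mean) ^+ 2 - N^-1 * \sum_i (G * d i) ^+ 2| <=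
  \sum_i ((G * d i) ^+ 2 / (N * q) + 2 * (`|G| * `|d i| * `|r i|) + q * r i ^+ 2).
Proof.
move=> q0 qN Nq d0 QE.
have N0 : 0 < N by apply: lt_trans qN.
set rbar := N^-1 * \sum_i r i.
have meanE : mean = c - q * rbar.
  rewrite /mean (eq_bigr _ (fun i _ => QE i)) sumrB big_split/= -!mulr_sumr d0.
  rewrite sumr_const card_ord -[c *+ _]mulr_natr -/N /rbar.
  by field; rewrite gt_eqF.
have devE i : Q i - mean = G * d i - q * (r i - rbar) by rewrite QE meanE; ring.
have rbarE : \sum_i r i = N * rbar by rewrite /rbar mulrA divff ?mul1r// gt_eqF.
set D := \sum_i (G * d i) ^+ 2.
set E := \sum_i (d i * r i).
set S := \sum_i r i ^+ 2.
have dev2 : \sum_i (Q i - mean) ^+ 2 = D - 2 * q * G * E + q ^+ 2 * (S - N * rbar ^+ 2).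
  have -> : q ^+ 2 * (S - N * rbar ^+ 2) =
      q ^+ 2 * S - 2 * q ^+ 2 * rbar * (N * rbar) + N * (q * rbar) ^+ 2 by ring.
  rewrite -rbarE.
  have -> : N * (q * rbar) ^+ 2 = \sum_(i < n.+1) (q * rbar) ^+ 2.
    by rewrite sumr_const card_ord -[RHS]mulr_natl.
  have -> : D = D + 2 * G * q * rbar * \sum_i d i by rewrite d0 mulr0 addr0.
  rewrite /D /E /S !mulr_sumr -!sumrN -!big_split/=; apply: eq_bigr => i _.
  by rewrite devE; ring.
rewrite dev2.
have -> : q^-1 * (D - 2 * q * G * E + q ^+ 2 * (S - N * rbar ^+ 2)) - N^-1 * D =
    D * (N - q) / (N * q) - 2 * (G * E) + q * (S - N * rbar ^+ 2).
  by field; rewrite !gt_eqF.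
have D0 : 0 <= D by apply: sumr_ge0 => i _; exact: sqr_ge0.
have S0 : 0 <= S - N * rbar ^+ 2.
  have : 0 <= \sum_i (r i - rbar) ^+ 2 by apply: sumr_ge0 => i _; exact: sqr_ge0.
  have -> // : \sum_i (r i - rbar) ^+ 2 = S - N * rbar ^+ 2.
  have -> : S - N * rbar ^+ 2 = S - 2 * rbar * (N * rbar) + N * rbar ^+ 2 by ring.
  rewrite -rbarE.
  have -> : N * rbar ^+ 2 = \sum_(i < n.+1) rbar ^+ 2.
    by rewrite sumr_const card_ord -[RHS]mulr_natl.
  rewrite /S !mulr_sumr -!sumrN -!big_split/=; apply: eq_bigr => i _; ring.
rewrite !big_split/= -mulr_suml -!mulr_sumr -/D -/S.
apply: (le_trans (ler_normD _ _)); apply: lerD; last first.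
  rewrite ger0_norm; last by rewrite mulr_ge0// ltW.
  rewrite ler_wpM2l ?(ltW q0)// gerBl mulr_ge0 ?sqr_ge0// ltW.
apply: (le_trans (ler_normB _ _)); apply: lerD.
  rewrite ger0_norm ?divr_ge0 ?mulr_ge0 ?(ltW q0) ?(ltW N0) ?subr_ge0 ?(ltW qN)//.
  by rewrite ler_wpM2r ?invr_ge0 ?mulr_ge0 ?(ltW q0) ?(ltW N0)// ler_piMr.
rewrite normrM ger0_norm// ler_wpM2l// normrM /E.
under [leRHS]eq_bigr do rewrite -mulrA.
rewrite -mulr_sumr ler_wpM2l//.
by apply: (le_trans (ler_norm_sum _ _ _)); apply: ler_sum => i _; rewrite normrM.
Qed.

Lemma powR_mean_le {R : realType} {n : nat} (x : 'I_n.+1 -> R) (r : R) : 1 < r ->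
  `|n.+1%:R^-1 * \sum_i x i| `^ r <= n.+1%:R^-1 * \sum_i `|x i| `^ r.
Proof.
move=> r1; have r0 : 0 < r by rewrite (lt_trans _ r1).
have n0 : 0 < n.+1%:R :> R by rewrite ltr0n.
set a := n.+1%:R^-1 * \sum_i `|x i|.
have a0 : 0 <= a by rewrite mulr_ge0 ?invr_ge0 ?ler0n ?sumr_ge0.
apply: (@le_trans _ _ (a `^ r)).
  apply: ge0_ler_powR; rewrite ?nnegrE ?normr_ge0// ?(ltW r0)//.
  rewrite normrM [`|_^-1|]gtr0_norm ?invr_gt0// ler_wpM2l ?invr_ge0 ?ler0n//.
  exact: ler_norm_sum.
have s0 : 0 < r / (r - 1) by rewrite divr_gt0// subr_gt0.
have r10 : r - 1 != 0 by rewrite gt_eqF// subr_gt0.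
have rs : r^-1 + (r / (r - 1))^-1 = 1.
  by field; rewrite ?r10 gt_eqF.
have arE : (a `^ (r - 1)) `^ (r / (r - 1)) = a `^ r.
  by rewrite -powRrM; congr (_ `^ _); field.
(* Young's inequality applied to |x_i| and a^(r-1), then averaged over i *)
have young i : `|x i| * a `^ (r - 1) <= `|x i| `^ r / r + a `^ r / (r / (r - 1)).
  by rewrite -[in leRHS]arE; apply: conjugate_powR => //; exact: powR_ge0.
have : a * a `^ (r - 1) <=
    n.+1%:R^-1 * \sum_i (`|x i| `^ r / r + a `^ r / (r / (r - 1))).
  rewrite {1}/a -mulrA mulr_suml ler_wpM2l ?invr_ge0 ?ler0n//.
  by apply: ler_sum.
rewrite mulr_powRB1// big_split/= -mulr_suml sumr_const card_ord.
rewrite -[(a `^ r / _) *+ _]mulr_natl mulrDr mulKf ?gt_eqF// mulrA.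
set A := a `^ r; set B := _ * \sum_i _ => AB.
have : A / r <= B / r.
  have -> : A / r = A - A / (r / (r - 1)) by field; rewrite r10 gt_eqF.
  by rewrite lerBlDr.
by rewrite ler_pM2r// invr_gt0.
Qed.

Lemma powR_add3_le {R : realType} (a b r : R) : 0 <= a -> 0 <= b -> 0 <= r ->
  (1 + a + b) `^ r <= 3 `^ r * (1 + a `^ r + b `^ r).
Proof.
move=> a0 b0 r0; set m := Num.max 1 (Num.max a b).
have m1 : 1 <= m by rewrite le_max lexx.
have ma : a <= m by rewrite !le_max lexx orbT.
have mb : b <= m by rewrite !le_max lexx !orbT.
apply: (@le_trans _ _ ((3 * m) `^ r)).
  by apply: ge0_ler_powR; rewrite ?nnegrE//; lra.
rewrite powRM//; last lra.
rewrite ler_wpM2l ?powR_ge0//.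
have := powR_ge0 a r; have := powR_ge0 b r.
rewrite /m; case: (leP 1 (Num.max a b)) => _; last by rewrite powR1; lra.
by case: (leP a b) => _; lra.
Qed.

Lemma holder_taylor {R : realType} {g : R -> R} {h C : R} : 0 < h ->
  (forall x, derivable g x 1) ->
  (forall x y, `|derive1 g x - derive1 g y| <= C * `|x - y| `^ h) ->
  forall x y, `|g y - g x - derive1 g x * (y - x)| <= C * `|y - x| `^ (1 + h).
Proof.
move=> h0 dg hol x y.
have C0 : 0 <= C.
  by have := hol 1 0; rewrite subr0 normr1 powR1 mulr1; apply: le_trans.
have mvt a b : a <= b -> exists2 c, a <= c <= b & g b - g a = derive1 g c * (b - a).
  move=> ab; have dg' z : z \in `]a, b[%R -> is_derive z 1 g (derive1 g z).
    by move=> _; rewrite derive1E; exact: derivableP.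
  have cg : {within `[a, b], continuous g}.
    by apply: derivable_within_continuous => z _; exact: dg.
  have [c cab E] := MVT_segment ab dg' cg.
  by exists c => //; move: cab; rewrite in_itv.
have [c cxy E] : exists2 c, `|c - x| <= `|y - x| & g y - g x = derive1 g c * (y - x).
  have [xy|/ltW yx] := leP x y.
    have [c /andP[xc cy] E] := mvt _ _ xy; exists c => //.
    by rewrite !ger0_norm ?subr_ge0// lerB.
  have [c /andP[yc cx] E] := mvt _ _ yx; exists c.
    by rewrite ![`|_ - x|]distrC !ger0_norm ?subr_ge0// lerB.
  by rewrite -opprB E; ring.
rewrite E -mulrBl normrM.
have [->|yx] := eqVneq y x; first by rewrite subrr normr0 mulr0 mulr_ge0 ?powR_ge0.
rewrite powRD; last by rewrite normr_eq0 subr_eq0 yx implybT.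
rewrite powRr1// mulrCA mulrC ler_wpM2l//.
apply: le_trans (hol c x) _; rewrite ler_wpM2l//.
by apply: ge0_ler_powR; rewrite ?nnegrE// ltW.
Qed.

Lemma v_jack_v_infjack_gap {R : realType} {g : R -> R} {h C : R} : 0 < h ->
    (forall x, derivable g x 1) ->
    (forall x y, `|derive1 g x - derive1 g y| <= C * `|x - y| `^ h) ->
  exists K, forall N (x : 'I_N.+2 -> R),
    `|v_jack g x - v_infjack g x| <=
    K * (N.+1%:R^-1 + N.+1%:R `^ (- h)) *
    (N.+2%:R^-1 * \sum_i (1 + `|x i| `^ (2 * (1 + h)))).
Proof.
move=> h0 dg hol; set rho := 2 * (1 + h).
have C0 : 0 <= C.
  by have := hol 1 0; rewrite subr0 normr1 powR1 mulr1; apply: le_trans.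
pose L := `|derive1 g 0| + C; have L0 : 0 <= L by rewrite addr_ge0.
exists (4 * 3 `^ rho * (L + C) ^+ 2).
move=> N x; set q : R := N.+1%:R.
have q1 : 1 <= q by rewrite ler1n.
have q0 : 0 < q by apply: lt_le_trans q1.
have nE : N.+2%:R = q + 1 :> R by rewrite natr1.
set M := charge_mean (emp x).
have ME : M = N.+2%:R^-1 * \sum_i x i by rewrite /M charge_mean_emp.
set G := derive1 g M.
pose d i := x i - M.
pose r i := g (charge_mean (emp_del x i)) - g M + G * d i / q.
have d0 : \sum_i d i = 0.
  rewrite sumrB sumr_const card_ord -[M *+ _]mulr_natl ME.
  by rewrite mulVKf ?subrr// gt_eqF// ltr0n.
have rE i : `|r i| <= C * (`|d i| / q) `^ (1 + h).
  have := holder_taylor h0 dg hol M (charge_mean (emp_del x i)).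
  rewrite charge_mean_emp_delE -/M -/q -/G -/(d i) [M - _ - M]addrAC subrr add0r normrN normrM.
  rewrite normfV (gtr0_norm q0); apply: le_trans.
  rewrite /r charge_mean_emp_delE -/M -/q -/(d i).
  by rewrite mulrN opprK mulrA.
have QE i : pseudovalue g x i = g M + G * d i - q * r i.
  rewrite /pseudovalue /functional_T -/M /r /= -/q nE; field.
  by rewrite gt_eqF.
have -> : v_infjack g x = N.+2%:R^-1 * \sum_i (G * d i) ^+ 2.
  by rewrite v_infjackE -ME.
have qN : q < N.+2%:R by rewrite nE ltrDl.
have Nq : N.+2%:R - q <= 1 by rewrite nE addrAC subrr add0r.
apply: (le_trans (jackknife_dispersion_gap q0 qN Nq d0 QE)).
pose t i := 1 + `|M| + `|x i|.
have t1 i : 1 <= t i by rewrite /t -addrA lerDl addr_ge0.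
have t0 i : 0 < t i by apply: lt_le_trans (t1 i).
have dt i : `|d i| <= t i.
  by apply: (le_trans (ler_normB _ _)); rewrite /t; have := t1 i; lra.
have Gt i : `|G| <= L * t i `^ h.
  have th1 : 1 <= t i `^ h by rewrite -(powRr0 (t i)) ler_powR// ltW.
  rewrite -[G](subrK (derive1 g 0)); apply: (le_trans (ler_normD _ _)).
  rewrite /L mulrDl addrC lerD// ?ler_peMr//.
  apply: le_trans (hol M 0) _; rewrite subr0 ler_wpM2l//.
  apply: ge0_ler_powR; rewrite ?nnegrE ?(ltW h0) ?(ltW (t0 i))//.
  by rewrite /t; have := normr_ge0 (x i); lra.
have rt i : `|r i| <= C * (t i `^ (1 + h) * q `^ (- (1 + h))).
  apply: le_trans (rE i) _; rewrite ler_wpM2l//.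
  rewrite powRM ?invr_ge0 ?(ltW q0)// -[q^-1]powR_inv1 ?(ltW q0)// -powRrM mulN1r.
  rewrite ler_wpM2r ?powR_ge0//.
  by apply: ge0_ler_powR; rewrite ?nnegrE ?(ltW (t0 i))// addr_ge0// ltW.
set b := q `^ (- (1 + h)).
have b0 : 0 <= b by exact: powR_ge0.
have rhoE i : t i `^ rho = (t i `^ (1 + h)) ^+ 2.
  by rewrite /rho mulrC powRrM powR_mulrn// powR_ge0.
have thE i : t i `^ (1 + h) = t i * t i `^ h.
  rewrite powRD ?powRr1 ?(ltW (t0 i))//.
  by rewrite (gt_eqF (t0 i)) implybT.
have bE : q * b = q `^ (- h).
  rewrite -[q in LHS]powRr1 ?(ltW q0)// -powRD; first by congr (_ `^ _); ring.
  by rewrite (gt_eqF q0) implybT.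
have b1 : q * b <= 1.
  by rewrite bE -(powRr0 q) ler_powR// oppr_le0 ltW.
apply: (@le_trans _ _ (\sum_i (L + C) ^+ 2 * t i `^ rho *
    ((N.+2%:R * q)^-1 + b))).
  apply: ler_sum => i _.
  have GdT : `|G| * `|d i| <= L * t i `^ (1 + h).
    by rewrite thE mulrCA [leRHS]mulrC ler_pM.
  rewrite rhoE; move: (rt i) GdT; set T := t i `^ (1 + h) => rT GdT.
  have T0 : 0 <= T by exact: powR_ge0.
  have term1 : (G * d i) ^+ 2 / (N.+2%:R * q) <= (L * T) ^+ 2 / (N.+2%:R * q).
    rewrite ler_wpM2r ?invr_ge0 ?mulr_ge0 ?ler0n ?(ltW q0)//.
    by rewrite -real_normK ?num_real// normrM lerXn2r ?nnegrE ?mulr_ge0.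
  have term2 : `|G| * `|d i| * `|r i| <= (L * T) * (C * (T * b)).
    by rewrite ler_pM ?mulr_ge0.
  have term3 : q * r i ^+ 2 <= (C * T) ^+ 2 * b.
    apply: (@le_trans _ _ (q * (C * (T * b)) ^+ 2)).
      rewrite ler_wpM2l ?(ltW q0)// -real_normK ?num_real//.
      by rewrite lerXn2r ?nnegrE ?mulr_ge0.
    have -> : q * (C * (T * b)) ^+ 2 = (C * T) ^+ 2 * b * (q * b) by ring.
    by rewrite ler_piMr ?mulr_ge0 ?sqr_ge0.
  set u := (N.+2%:R * q)^-1 in term1 *.
  have u0 : 0 <= u by rewrite invr_ge0 mulr_ge0 ?ler0n ?(ltW q0).
  apply: (le_trans (lerD (lerD term1 (ler_wpM2l _ term2)) term3)) => //.
  rewrite -subr_ge0.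
  have -> : (L + C) ^+ 2 * T ^+ 2 * (u + b) - ((L * T) ^+ 2 * u +
      2 * (L * T * (C * (T * b))) + (C * T) ^+ 2 * b) =
      (2 * (L * C) + C ^+ 2) * T ^+ 2 * u + L ^+ 2 * T ^+ 2 * b by ring.
  by rewrite addr_ge0 ?mulr_ge0 ?addr_ge0 ?mulr_ge0 ?sqr_ge0.
have n0 : 0 < N.+2%:R :> R by rewrite ltr0n.
have rho0 : 0 <= rho by rewrite mulr_ge0 ?addr_ge0// ltW.
have rho1 : 1 < rho by rewrite /rho; lra.
set W := \sum_i (1 + `|x i| `^ rho).
have tW : \sum_i t i `^ rho <= 2 * 3 `^ rho * W.
  apply: (@le_trans _ _ (\sum_i 3 `^ rho * (1 + `|M| `^ rho + `|x i| `^ rho))).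
    by apply: ler_sum => i _; exact: powR_add3_le.
  rewrite -mulr_sumr mulrAC mulrC ler_wpM2r ?powR_ge0//.
  rewrite /W !big_split/= !sumr_const !card_ord -[_ `^ _ *+ _]mulr_natl.
  have : N.+2%:R * `|M| `^ rho <= \sum_i `|x i| `^ rho.
    rewrite -[leRHS](mulVKf (lt0r_neq0 n0)) ler_wpM2l ?ler0n// ME.
    exact: powR_mean_le.
  have : 0 <= N.+2%:R :> R by rewrite ler0n.
  lra.
have W0 : 0 <= W by apply: sumr_ge0 => i _; rewrite addr_ge0 ?powR_ge0.
rewrite -mulr_suml -mulr_sumr.
have nb : (N.+2%:R * q)^-1 + b <= 2 * (q^-1 + q `^ (- h)) * N.+2%:R^-1.
  rewrite ler_pdivlMr// mulrDl invfM mulrAC mulVf ?gt_eqF// mul1r -bE nE.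
  have : b <= q * b by rewrite ler_peMl.
  have : 0 <= q^-1 by rewrite invr_ge0 ltW.
  by rewrite [b * (q + 1)]mulrDr mulr1 [b * q]mulrC; move: (q * b) (q^-1) => u v; lra.
have LC0 : 0 <= (L + C) ^+ 2 by exact: sqr_ge0.
apply: (@le_trans _ _ ((L + C) ^+ 2 * (2 * 3 `^ rho * W) *
    (2 * (q^-1 + q `^ (- h)) * N.+2%:R^-1))); last first.
  by rewrite le_eqVlt; apply/orP; left; apply/eqP; ring.
apply: ler_pM => //.
- by rewrite mulr_ge0// sumr_ge0// => i _; exact: powR_ge0.
- by rewrite addr_ge0// invr_ge0 mulr_ge0// ?ler0n ?(ltW q0).
- exact: ler_wpM2l.
Qed.

(** * Convergence in distribution *)

Lemma unif_continuous_on_segment {R : realType} {f : R -> R} (b eta : R) :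
  continuous f -> 0 < eta -> exists2 e, 0 < e &
    forall z y, `|z| <= b -> `|y - z| < e -> `|f y - f z| <= eta.
Proof.
move=> cf eta0.
have /compact_near_coveringP cover := @segment_compact R (- b) b.
pose Q (e z : R) := forall y, `|y - z| < e -> `|f y - f z| <= eta.
have [e0 e00 He] : \forall e \near 0^'+, `[- b, b] `<=` Q e.
  apply: cover => z _.
  have eta20 : 0 < eta / 2 by rewrite divr_gt0.
  have /cvgr_dist_lt/(_ _ eta20)/nbhs_ballP[a /= a0 fz] := cf z.
  have a20 : 0 < a / 2 by rewrite divr_gt0.
  exists (ball z (a / 2), [set e | e < a / 2]) => /=.
    by split; [exact: nbhsx_ballx|exact: nbhs_right_lt].
  move=> [z' e] /= [zz' ea] y yz'.
  have {}zz' : `|z - z'| < a / 2 by exact: zz'.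
  have fzz' : `|f z - f z'| < eta / 2 by apply: fz; rewrite /ball/=; lra.
  have fzy : `|f z - f y| < eta / 2.
    apply: fz; rewrite /ball/=; apply: le_lt_trans (ler_distD z' _ _) _.
    by rewrite [`|z' - y|]distrC; lra.
  apply: (le_trans (ler_distD (f z) _ _)).
  by rewrite [`|f y - f z|]distrC; lra.
have e20 : 0 < e0 / 2 by rewrite divr_gt0.
exists (e0 / 2) => // z y zb; apply: (He (e0 / 2)) => //.
- by rewrite /= sub0r normrN gtr0_norm// ltr_pdivrMr// ltr_pMr// ltr1n.
- by rewrite /= in_itv/= -ler_norml.
Qed.

Lemma bounded_fun_le {T : Type} {R : realFieldType} {f : T -> R} (K : R) :
  (forall y, `|f y| <= K) -> bounded_fun f.
Proof.
move=> fK; exists K; split; first exact: num_real.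
by move=> M KM y _; exact: le_trans (fK y) (ltW KM).
Qed.

Section tail.
Context {R : realType}.

Definition tail (k : nat) (y : R) : R := y ^+ 2 / (k.+1%:R + y ^+ 2).

Lemma continuous_tail k : continuous (tail k).
Proof.
move=> y; apply: cvgM; first exact: exprn_continuous.
apply: cvgV; first by rewrite gt_eqF// ltr_wpDr ?sqr_ge0.
by apply: cvgD; [exact: cvg_cst|exact: exprn_continuous].
Qed.

Lemma tail_ge0 k y : 0 <= tail k y.
Proof. by rewrite divr_ge0 ?addr_ge0 ?sqr_ge0. Qed.

Lemma tail_le1 k y : tail k y <= 1.
Proof.
by rewrite ler_pdivrMr ?mul1r ?ltr_wpDr ?sqr_ge0// lerDr.
Qed.

Lemma bounded_tail k : bounded_fun (tail k).
Proof.
by apply: (bounded_fun_le 1) => y; rewrite ger0_norm ?tail_ge0 ?tail_le1.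
Qed.

Lemma tail_ge_half k y : k.+1%:R < `|y| -> 2^-1 <= tail k y.
Proof.
move=> ky; rewrite ler_pdivlMr ?ltr_wpDr ?sqr_ge0//.
have : k.+1%:R <= y ^+ 2.
  rewrite -real_normK ?num_real// expr2.
  apply: (le_trans (ltW ky)); rewrite ler_peMr// (le_trans _ (ltW ky))//.
  by rewrite ler1n.
lra.
Qed.

Lemma tail_integral_small (mu : probability R R) (e : R) : 0 < e ->
  exists k, \int[mu]_y tail k y < e.
Proof.
move=> e0.
have : fine (\int[mu]_y (tail k y)%:E)%E @[k --> \oo] --> (0 : R).
  apply: fine_cvg; rewrite -[X in _ --> X](integral0 mu setT).
  apply: (@dominated_cvg _ _ _ mu setT measurableT _ (cst 0%E) (cst 1%E)) => //.
  - move=> k; apply/measurable_EFinP.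
    by apply: continuous_measurable_fun; exact: continuous_tail.
  - move=> y _; apply/fine_cvgP; split; first exact: nearW.
    apply: (@squeeze_cvgr _ _ _ _ (cst 0) (fun k => y ^+ 2 * harmonic k)).
    + apply: nearW => k; rewrite tail_ge0 /= /tail.
      rewrite ler_wpM2l ?sqr_ge0// lef_pV2 ?posrE ?ltr_wpDr ?sqr_ge0//.
      by rewrite lerDl sqr_ge0.
    + exact: cvg_cst.
    + by rewrite -[X in _ --> X](mulr0 (y ^+ 2)); apply: cvgMr; exact: cvg_harmonic.
  - exact: finite_measure_integrable_cst.
  - by move=> k y _; rewrite lee_fin ger0_norm ?tail_ge0 ?tail_le1.
move=> /cvgr0_norm_lt /(_ _ e0) [k _ /(_ k (leqnn k))] H.
by exists k; apply: le_lt_trans H; exact: ler_norm.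
Qed.

End tail.

Lemma bounded_integrable {d} {T : measurableType d} {R : realType}
    (P : probability T R) (f : T -> R) : measurable_fun setT f -> bounded_fun f ->
  P.-integrable setT (EFin \o f).
Proof.
move=> mf bf; apply: measurable_bounded_integrable => //.
exact: le_lt_trans (probability_le1 P measurableT) (ltry _).
Qed.

(* The test function [tail k] transfers the tightness of the limit law to Z, which
   is what allows f to be merely continuous. *)
Lemma cvg_in_distribution_close {d} {T : measurableType d} {R : realType}
    {P : probability T R} {Y Z D : nat -> T -> R} (mu : probability R R) :
  (forall n, measurable_fun setT (Y n)) -> (forall n, measurable_fun setT (Z n)) ->
  (forall n, P.-integrable setT (EFin \o D n)) ->
  (\forall n \near \oo, forall w, `|Y n w - Z n w| <= D n w) ->
  (\int[P]_w D n w) @[n --> \oo] --> 0 ->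
  cvg_in_distribution P Z mu -> cvg_in_distribution P Y mu.
Proof.
move=> mY mZ iD YZ D0 cZ f cf bf.
have mf := continuous_measurable_fun cf.
apply: cvg_sub0 (cZ f cf bf).
apply/cvgr0Pnorm_le => e e0.
have [K K0 fK] : exists2 K, 0 < K & forall y, `|f y| <= K.
  have [K K0 H] := ex_strict_bound_gt0 bf.
  by exists K => // y; exact/ltW/H.
have eK : 0 < e / 4 / (4 * K) by rewrite !divr_gt0// mulr_gt0.
have bfc (X : T -> R) : bounded_fun (f \o X).
  by apply: (bounded_fun_le K) => w; exact: fK.
have btc k (X : T -> R) : bounded_fun (tail k \o X).
  by apply: (bounded_fun_le 1) => w /=; rewrite ger0_norm ?tail_ge0 ?tail_le1.
have e4 : 0 < e / 4 by rewrite divr_gt0.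
have [k tk] := tail_integral_small mu _ eK.
have [a a0 fa] := unif_continuous_on_segment k.+1%:R (e / 4) cf e4.
have ct := cZ _ (continuous_tail k) (bounded_tail k).
have mtail : measurable_fun setT (@tail R k).
  by apply: continuous_measurable_fun; exact: continuous_tail.
have eKa : 0 < e / 4 / (2 * K / a) by rewrite !divr_gt0// mulr_gt0.
have near_t : \forall n \near \oo, \int[P]_w tail k (Z n w) < e / 4 / (4 * K).
  by have /cvgr_lt := ct; exact.
have near_D : \forall n \near \oo, \int[P]_w D n w < e / 4 / (2 * K / a).
  by have /cvgr_lt := D0; exact.
near=> n.
have it : P.-integrable setT (EFin \o (tail k \o Z n)).
  by apply: bounded_integrable => //; exact: measurableT_comp.
have itail := integrableZl measurableT (4 * K) it.
have iDn := integrableZl measurableT (2 * K / a) (iD n).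
have ic := @finite_measure_integrable_cst _ _ _ P setT (e / 4) measurableT.
have ict := integrableD measurableT ic itail.
have ictD := integrableD measurableT ict iDn.
have iY : P.-integrable setT (EFin \o (f \o Y n)).
  by apply: bounded_integrable => //; apply: measurableT_comp.
have iZ : P.-integrable setT (EFin \o (f \o Z n)).
  by apply: bounded_integrable => //; apply: measurableT_comp.
have iYZ : P.-integrable setT (EFin \o (fun w => f (Y n w) - f (Z n w))).
  exact: (integrableB measurableT iY iZ).
have YZn : forall w, `|Y n w - Z n w| <= D n w by near: n.
have pointwise w : `|f (Y n w) - f (Z n w)| <=
    e / 4 + 4 * K * tail k (Z n w) + 2 * K / a * D n w.
  have D0w : 0 <= 2 * K / a * D n w.
    rewrite mulr_ge0 ?divr_ge0 ?(ltW a0)//; first lra.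
    exact: le_trans (YZn w).
  have T0 : 0 <= 4 * K * tail k (Z n w) by rewrite mulr_ge0 ?tail_ge0//; lra.
  have f2K : `|f (Y n w) - f (Z n w)| <= 2 * K.
    by apply: (le_trans (ler_normB _ _)); have := fK (Y n w); have := fK (Z n w); lra.
  have [Zk|/tail_ge_half Zk] := leP `|Z n w| k.+1%:R; last first.
    have : 4 * K * 2^-1 <= 4 * K * tail k (Z n w) by rewrite ler_wpM2l//; lra.
    lra.
  have [YZa|aYZ] := ltP `|Y n w - Z n w| a; first by have := fa _ _ Zk YZa; lra.
  have : 2 * K / a * a <= 2 * K / a * D n w.
    by rewrite ler_wpM2l ?divr_ge0 ?(ltW a0)//; [lra|exact: le_trans (YZn w)].
  rewrite divfK ?gt_eqF//; lra.
rewrite -[X in `|X|](@RintegralB _ _ _ P setT (f \o Y n) (f \o Z n))//.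
apply: (le_trans (le_normr_Rintegral measurableT iYZ)).
apply: (@le_trans _ _ (\int[P]_w (e / 4 + 4 * K * tail k (Z n w) + 2 * K / a * D n w))).
  by apply: le_Rintegral => //; exact: integrable_norm iYZ.
rewrite (RintegralD measurableT ict iDn) (RintegralD measurableT ic itail).
have P1 : fine (P setT) = 1 by rewrite probability_setT.
rewrite Rintegral_cst// P1 mulr1 !RintegralZl//.
have t1 : \int[P]_w tail k (Z n w) < e / 4 / (4 * K) by near: n.
have d1 : \int[P]_w D n w < e / 4 / (2 * K / a) by near: n.
apply: (@le_trans _ _ (e / 4 + e / 4 + e / 4)); last lra.
apply: lerD; first (apply: lerD => //).
- by rewrite mulrC -ler_pdivlMr ?mulr_gt0//; exact: ltW.
- by rewrite mulrC -ler_pdivlMr ?divr_gt0 ?mulr_gt0//; exact: ltW.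
Unshelve. all: by end_near.
Qed.

(** * Measurability, moments and rates *)

Lemma Rintegral_sum {d} {T : measurableType d} {R : realType}
    (mu : {measure set T -> \bar R}) {I : Type} (s : seq I) (f : I -> T -> R) :
  (forall i, mu.-integrable setT (EFin \o f i)) ->
  mu.-integrable setT (EFin \o (fun w => \sum_(i <- s) f i w)) /\
  \int[mu]_w (\sum_(i <- s) f i w) = \sum_(i <- s) \int[mu]_w f i w.
Proof.
move=> fi; elim: s => [|i s [IHi IHe]].
  rewrite big_nil; split.
    by under eq_fun do rewrite big_nil; exact: integrable0.
  by under eq_Rintegral do rewrite big_nil; rewrite /Rintegral integral0.
have iD := integrableD measurableT (fi i) IHi; split.
  by under eq_fun do rewrite big_cons.
by under eq_Rintegral do rewrite big_cons; rewrite RintegralD// IHe big_cons.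
Qed.

Lemma powRN_natr_cvg0 {R : realType} (a : R) : 0 < a ->
  (fun N => N.+1%:R `^ (- a)) @ \oo --> (0 : R).
Proof.
move=> a0; have /cvg_at_rightP/(_ harmonic) := powR_cvg0 a0.
have -> : (fun N => harmonic N `^ a) = (fun N => N.+1%:R `^ (- a) : R).
  by apply/funext => N; rewrite /harmonic/= -[N.+1%:R^-1]powR_inv1// -powRrM mulN1r.
by apply; split; [move=> N; rewrite invr_gt0|exact: cvg_harmonic].
Qed.

Lemma sqrt_jackknife_rate_cvg0 {R : realType} (K h : R) : 1 / 2 < h ->
  (fun n => Num.sqrt n%:R * (K * (n.-1%:R^-1 + n.-1%:R `^ (- h)))) @ \oo --> (0 : R).
Proof.
move=> h12; rewrite -(cvg_shiftn 2).
have b1 : (0 : R) < 1 / 2 by lra.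
have b2 : 0 < h - 1 / 2 by lra.
have lim : (fun N => Num.sqrt 2 * `|K| * (N.+1%:R `^ (- (1 / 2)) +
    N.+1%:R `^ (- (h - 1 / 2)))) @ \oo --> (0 : R).
  rewrite [X in _ --> X](_ : 0 = Num.sqrt 2 * `|K| * (0 + 0)); last first.
    by rewrite addr0 mulr0.
  by apply: cvgMr; apply: cvgD; exact: powRN_natr_cvg0.
apply/norm_cvg0P; apply: (squeeze_cvgr _ (cvg_cst 0) lim).
apply: nearW => N /=; rewrite normr_ge0 /= addn2 /= normrM (ger0_norm (sqrtr_ge0 _)).
set q : R := N.+1%:R.
have q1 : 1 <= q by rewrite ler1n.
have q0 : 0 < q by apply: lt_le_trans q1.
have sq : q `^ (1 / 2) = Num.sqrt q by rewrite div1r powR12_sqrt// ltW.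
have qD a b : q `^ (a + b) = q `^ a * q `^ b by rewrite powRD// (gt_eqF q0) implybT.
have -> : q `^ (- (1 / 2)) = Num.sqrt q * q^-1.
  by rewrite -sq -[q^-1]powR_inv1 ?(ltW q0)// -qD; congr (_ `^ _); lra.
have -> : q `^ (- (h - 1 / 2)) = Num.sqrt q * q `^ (- h).
  by rewrite -sq -qD; congr (_ `^ _); lra.
have r0 : 0 <= q^-1 + q `^ (- h) by rewrite addr_ge0 ?powR_ge0 ?invr_ge0 ?(ltW q0).
rewrite normrM (ger0_norm r0) -mulrDr.
have -> : Num.sqrt 2 * `|K| * (Num.sqrt q * (q^-1 + q `^ (- h))) =
  Num.sqrt 2 * Num.sqrt q * (`|K| * (q^-1 + q `^ (- h))) by ring.
rewrite ler_wpM2r ?mulr_ge0// -sqrtrM// ler_sqrt ?mulr_ge0 ?(ltW q0)//.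
by rewrite -natrM ler_nat mul2n -addnn -[N.+2]addn1 leq_add2l.
Qed.

Section estimators_measurable.
Context {d} {T : measurableType d} {R : realType} {n : nat} {x : 'I_n -> T -> R}.
Context (mx : forall i, measurable_fun setT (x i)).

Let measurable_sum_pred (I : pred 'I_n) :
  measurable_fun setT (fun w => \sum_(i < n | I i) x i w).
Proof.
under eq_fun do rewrite big_mkcond /=.
by apply: measurable_sum => i; case: (I i).
Qed.

Lemma measurable_v_jack {g : R -> R} : measurable_fun setT g ->
  measurable_fun setT (fun w => v_jack g (x^~ w)).
Proof.
move=> mg.
have mQ i : measurable_fun setT (fun w => pseudovalue g (x^~ w) i).
  rewrite /pseudovalue /functional_T.
  under eq_fun do rewrite charge_mean_emp charge_mean_emp_del.
  by apply: measurable_funB; apply: measurable_funM => //;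
    apply: measurableT_comp => //; exact: measurable_funM.
apply: measurable_funM => //; apply: measurable_sum => i; apply: measurable_funX.
apply: measurable_funB => //.
by apply: measurable_funM => //; exact: measurable_sum.
Qed.

Lemma measurable_v_infjack {g : R -> R} : measurable_fun setT (derive1 g) ->
  measurable_fun setT (fun w => v_infjack g (x^~ w)).
Proof.
move=> mg; under eq_fun do rewrite v_infjackE.
have mM : measurable_fun setT (fun w => n%:R^-1 * \sum_(i < n) x i w).
  exact: measurable_funM.
apply: measurable_funM => //; apply: measurable_sum => i; apply: measurable_funX.
by apply: measurable_funM; [exact: measurableT_comp|exact: measurable_funB].
Qed.

End estimators_measurable.

Lemma iid_powR_moment {d} {Omega : measurableType d} {R : realType}
    {P : probability Omega R} {X : nat -> {RV P >-> R}} {p : probability R R}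
    {r : R} : iid_with_law X p -> finite_abs_moment p r ->
  forall i, P.-integrable setT (EFin \o (fun w => `|X i w| `^ r)) /\
    \int[P]_w (`|X i w| `^ r) = \int[p]_y (`|y| `^ r).
Proof.
move=> [_ Xp] pr i.
have mf : measurable_fun setT (fun y : R => `|y| `^ r).
  by apply: (measurableT_comp (measurable_powR _)); exact: normr_measurable.
have E : (\int[P]_w (`|X i w| `^ r)%:E = \int[p]_y (`|y| `^ r)%:E)%E.
  transitivity (\int[distribution P (X i)]_y (`|y| `^ r)%:E)%E.
    by rewrite ge0_integral_distribution//; exact/measurable_EFinP.
  by apply: eq_measure_integral => A mA _; exact: Xp.
split; last by rewrite /Rintegral E.
apply/integrableP; split.
  by apply/measurable_EFinP; apply: (measurableT_comp mf).
rewrite -[ltLHS]/(\int[P]_w `|(`|X i w| `^ r)%:E|)%E.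
by under eq_integral do rewrite gee0_abs ?lee_fin ?powR_ge0//; rewrite E.
Qed.

Theorem proposition2 (R : realType) (d : measure_display)
    (Omega : measurableType d) (P : probability Omega R)
    (X : nat -> {RV P >-> R}) (p : probability R R) (g : R -> R) (h : R)
    (hg : C1 g) (hX : iid_with_law X p)
    (hh : 1 / 2 < h) (hholder : holder_continuous h (derive1 g))
    (hmom : finite_abs_moment p (2 * (1 + h))) :
  let sigma2 := asymptotic_variance g p in
  let data n (w : Omega) := fun i : 'I_n => X i w in
  let A n (w : Omega) := Num.sqrt n%:R * (v_jack g (data n w) - sigma2) in
  let B n (w : Omega) := Num.sqrt n%:R * (v_infjack g (data n w) - sigma2) in
  forall mu : probability R R,
    cvg_in_distribution P A mu <-> cvg_in_distribution P B mu.
Proof.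
move=> sigma2 data A B mu.
have [dg cdg] := hg; have [C hol] := hholder.
have h0 : 0 < h by lra.
have mg : measurable_fun setT g.
  apply: continuous_measurable_fun => y.
  exact/differentiable_continuous/derivable1_diffP.
have mX n (i : 'I_n) : measurable_fun setT (fun w => X i w) by exact: measurable_funP.
have mA n : measurable_fun setT (A n).
  apply: measurable_funM => //; apply: measurable_funB => //.
  exact: (measurable_v_jack (mX n) mg).
have mB n : measurable_fun setT (B n).
  apply: measurable_funM => //; apply: measurable_funB => //.
  exact: (measurable_v_infjack (mX n) (continuous_measurable_fun cdg)).
have [K gap] := v_jack_v_infjack_gap h0 dg hol.
set rho := 2 * (1 + h) in hmom gap.
pose c n : R := Num.sqrt n%:R * (K * (n.-1%:R^-1 + n.-1%:R `^ (- h))).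
pose D n w := c n * (n%:R^-1 * \sum_(i < n) (1 + `|X i w| `^ rho)).
have gapD : \forall n \near \oo, forall w, `|A n w - B n w| <= D n w.
  exists 2%N => // -[//|[//|N]] _ w.
  rewrite /A /B -mulrBr opprB addrA subrK normrM ger0_norm ?sqrtr_ge0//.
  by rewrite /D /c -mulrA ler_wpM2l ?sqrtr_ge0//; exact: (gap N (data N.+2 w)).
pose m : R := \int[p]_y (`|y| `^ rho).
have one_moment i : P.-integrable setT (EFin \o (fun w => 1 + `|X i w| `^ rho)) /\
    \int[P]_w (1 + `|X i w| `^ rho) = 1 + m.
  have [iX EX] := iid_powR_moment hX hmom i.
  have i1 := @finite_measure_integrable_cst _ _ _ P setT (1 : R) measurableT.
  split; first exact: (integrableD measurableT i1 iX).
  rewrite (RintegralD measurableT i1 iX) EX Rintegral_cst//.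
  have P1 : fine (P setT) = 1 by rewrite probability_setT.
  by rewrite P1 mulr1.
have sumD n := Rintegral_sum P (index_enum 'I_n)
  (fun i : 'I_n => fun w => 1 + `|X i w| `^ rho) (fun i => (one_moment i).1).
have iS n := integrableZl measurableT n%:R^-1 (sumD n).1.
have iD n : P.-integrable setT (EFin \o D n).
  exact: (integrableZl measurableT (c n) (iS n)).
have D0 : (\int[P]_w D n w) @[n --> \oo] --> 0.
  have : c n * (1 + m) @[n --> \oo] --> 0.
    rewrite -[X in _ --> X](mul0r (1 + m)); apply: cvgMl.
    exact: sqrt_jackknife_rate_cvg0.
  apply: cvg_trans; apply: near_eq_cvg; exists 1%N => // n n1.
  rewrite /D RintegralZl//; last exact: (iS n).
  rewrite RintegralZl//; last exact: (sumD n).1.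
  rewrite (sumD n).2.
  under eq_bigr do rewrite (one_moment _).2.
  rewrite sumr_const card_ord.
  by rewrite -[(1 + m) *+ n]mulr_natl mulKf// pnatr_eq0 -lt0n.
split; apply: (cvg_in_distribution_close mu _ _ iD) => //.
near=> n => w; rewrite distrC; move: w; near: n; exact: gapD.
Unshelve. all: by end_near.
Qed.
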